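(* There is an absolute constant $C>0$ such that for infinitely many $n$ the following holds: any distance labeling scheme for the class of undirected unweighted graphs on $n$ vertices with maximum degree $3$ assigns, on some graph of this class, to some vertex a label of at least $\frac{1}{2^{C\sqrt{\log n}}}\textsc{SumIndex}(n)$ bits.
   Context: A distance labeling scheme for a class $\mathcal F$ of graphs consists of a fixed decoding function $f$ and, for each $G\in\mathcal F$, an assignment of binary strings $\mathsf{label}(u)$ to the vertices such that $f(\mathsf{label}(u),\mathsf{label}(v))=\mathrm{dist}_G(u,v)$ for all $u,v\in V(G)$. Sum-Index problem on $\mathbb Z_n$: a string $S\in\{0,1\}^n$ is known to both Alice and Bob; Alice also holds $a\in[0,n-1]$ and Bob holds $b\in[0,n-1]$; each simultaneously sends one message to a referee, who must compute $S_{(a+b)\bmod n}$ from the two messages alone. $\textsc{SumIndex}(n)$ is the communication complexity of this problem: the minimum, over deterministic such protocols, of the maximum message length in bits. *)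

(* Defs.v *)
From mathcomp Require Import all_boot.
From Stdlib Require Import ClassicalEpsilon.

Set Implicit Arguments.
Unset Strict Implicit.
Unset Printing Implicit Defensive.

Definition maxdeg3_graph (n : nat) (G : rel 'I_n) : bool :=
  [&& [forall u, ~~ G u u],
      [forall u, forall v, G u v == G v u] &
      [forall u, #|[set v | G u v]| <= 3]].

Definition walk_of_length (n : nat) (G : rel 'I_n) (u v : 'I_n) (k : nat)
  : bool :=
  [exists p : k.-tuple 'I_n, path G u p && (last u p == v)].

(* dist_G(u,v): the least k admitting a walk of length k from u to v
   (a shortest walk has length < n, so searching k < n suffices);
   None encodes infinite distance (u, v in different components). *)
Definition dist (n : nat) (G : rel 'I_n) (u v : 'I_n) : option nat :=
  let k := find (walk_of_length G u v) (iota 0 n) in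
  if k < n then Some k else None.

Definition is_distance_labeling_scheme (n : nat)
  (f : seq bool -> seq bool -> option nat)
  (label : rel 'I_n -> 'I_n -> seq bool) : Prop :=
  forall G : rel 'I_n, maxdeg3_graph G ->
    forall u v : 'I_n, f (label G u) (label G v) = dist G u v.

Definition sumindex_protocol_correct (n : nat)
  (A B : n.-tuple bool -> 'I_n -> seq bool)
  (R : seq bool -> seq bool -> bool) : Prop :=
  forall (S : n.-tuple bool) (a b : 'I_n),
    R (A S a) (B S b) = nth false S ((a + b) %% n).

Definition protocol_cost_le (n : nat)
  (A B : n.-tuple bool -> 'I_n -> seq bool) (k : nat) : Prop :=
  (forall S a, size (A S a) <= k) /\ (forall S b, size (B S b) <= k).

Definition sumindex_ub (n k : nat) : Prop :=
  exists A B R, sumindex_protocol_correct (n:=n) A B R /\ protocol_cost_le A B k.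

Lemma sumindex_ub_n (n : nat) : sumindex_ub n n.
Proof.
exists (fun S a => [seq nth false S ((a + j) %% n) | j <- iota 0 n]).
exists (fun S b => nseq b true).
exists (fun ma mb => nth false ma (size mb)).
split.
- move=> S a b /=.
  by rewrite size_nseq (nth_map 0) ?size_iota ?ltn_ord // nth_iota ?ltn_ord.
- split=> S x /=; first by rewrite size_map size_iota.
  by rewrite size_nseq ltnW ?ltn_ord.
Qed.

Definition pdec (P : Prop) : bool :=
  if excluded_middle_informative P then true else false.

Lemma pdecP (P : Prop) : reflect P (pdec P).
Proof. by rewrite /pdec; case: excluded_middle_informative => h; constructor. Qed.

Lemma sumindex_ex (n : nat) : exists k, pdec (sumindex_ub n k).
Proof. by exists n; apply/pdecP; apply: sumindex_ub_n. Qed.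

Definition SumIndex (n : nat) : nat := ex_minn (sumindex_ex n).

(* Main.v *)
Require Import Defs.
From mathcomp Require Import all_boot.
From Stdlib Require Import Reals Lra Classical_Prop.
From mathcomp Require Import ssrnat zify.

Set Implicit Arguments.
Unset Strict Implicit.
Unset Printing Implicit Defensive.

(* Write the block offsets of Alice and Bob as digit vectors x and z in base
   q = 2^t with t digits, so that adding the vectors without carries gives the
   digits (up to 2q - 2) of an index into a block of S.  In a layered graph, a
   path from x on the left to z on the right replaces the coordinates of x one
   by one by those of some vector y, crosses the middle at y, and goes to z
   symmetrically.  The cost of a coordinate is y_i^2 - 4 x_i y_i plus a term
   independent of y_i, so the total is smallest exactly for y = x + z; the
   middle edge at y is present iff the corresponding bit of S is 1, hence the
   distance reveals the bit.  Edge weights are polynomial in q, so the graph has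
   n = 2^(t^2 + O(t)) vertices while a block has about 2^(t^2) bits.  For a
   string of length n the players send one label for each of the 2^(O(t))
   blocks, which costs 2^(O(sqrt (log n))) times the label length. *)

(** * Walks and distances *)

Section Walks.
Variables (T : eqType) (e : rel T).

Definition walk (u v : T) (k : nat) :=
  exists p, [/\ path e u p, last u p = v & size p = k].

Lemma walk0 u : walk u u 0.
Proof. by exists [::]. Qed.

Lemma walk1 u v : e u v -> walk u v 1.
Proof. by move=> euv; exists [:: v]; rewrite /= euv. Qed.

Lemma walk_trans v u w j k : walk u v j -> walk v w k -> walk u w (j + k).
Proof.
move=> [p [pp pl <-]] [p' [pp' pl' <-]]; exists (p ++ p').
by rewrite cat_path last_cat size_cat pl pp.
Qed.

Lemma walk_sym u v k : symmetric e -> walk u v k -> walk v u k.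
Proof.
move=> es [p [pp <- <-]]; exists (rev (belast u p)); split.
- rewrite rev_path; apply: sub_path pp => x y; by rewrite es.
- by case: p {pp} => //= x p; rewrite rev_cons last_rcons.
- by rewrite size_rev size_belast.
Qed.

(** Lower bounds on distances all come from potentials that grow by at most 1 along an edge. *)
Lemma walk_lipschitz (psi : T -> nat) u v k :
  (forall x y, e x y -> psi y <= psi x + 1) -> walk u v k ->
  psi v <= psi u + k.
Proof.
move=> lip [p [pp <- <-]]; elim: p u pp => [|x p IH] u /=; first by rewrite addn0.
by move=> /andP[/lip h /IH]; lia.
Qed.

End Walks.

Section Distance.
Variables (n : nat) (G : rel 'I_n).

Lemma walk_of_lengthP u v k : reflect (walk G u v k) (walk_of_length G u v k).
Proof.
apply: (iffP existsP) => [[p /andP[pp /eqP pl]]|[p [pp pl ps]]].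
  by exists p; rewrite size_tuple.
by exists (tcast ps (in_tuple p)); rewrite val_tcast pp pl eqxx.
Qed.

Lemma dist_Some_walk u v k : Defs.dist G u v = Some k -> walk G u v k.
Proof.
rewrite /Defs.dist; case: ifP => // lt_n [<-]; apply/walk_of_lengthP.
have := nth_find 0 (_ : has (walk_of_length G u v) (iota 0 n)).
by rewrite nth_iota // add0n; apply; rewrite has_find size_iota.
Qed.

Lemma walk_dist_leq u v k :
  walk G u v k -> k < n -> exists2 k', Defs.dist G u v = Some k' & k' <= k.
Proof.
move=> /walk_of_lengthP wk ltkn.
have le_k : find (walk_of_length G u v) (iota 0 n) <= k.
  rewrite leqNgt; apply/negP => /(before_find 0).
  by rewrite nth_iota // add0n wk.
by rewrite /Defs.dist (leq_ltn_trans le_k ltkn); exists (find (walk_of_length G u v) (iota 0 n)).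
Qed.

End Distance.

(** * Subdivision of a weighted graph *)

Section Subdivision.
(* A weighted graph given by at most two outgoing edges per vertex; the edge
   [nxt v p] has weight [len v p + 2] and is replaced by a path with
   [len v p + 1] inner vertices [inr (v, p, j)], [j <= len v p]. *)
Variables (V : finType) (W : nat).
Variables (nxt : V -> bool -> option V) (len : V -> bool -> nat).

(** Indices [j > len v p] give isolated vertices and absent edges give detached paths, so the vertex
    set is the same whichever edges are present. *)
Definition subdiv_vertex : finType := (V + V * bool * 'I_W)%type.

Definition subdiv_step : rel subdiv_vertex := fun x y =>
  match x, y with
  | inl v, inr (v', p, j) => [&& v == v', j == 0 :> nat & isSome (nxt v p)]
  | inr (v, p, j), inr (v', p', j') =>
      [&& v == v', p == p', j' == j.+1 :> nat & j < len v p]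
  | inr (v, p, j), inl v' => (j == len v p :> nat) && (nxt v p == Some v')
  | _, _ => false
  end.

Definition subdiv : rel subdiv_vertex :=
  fun x y => subdiv_step x y || subdiv_step y x.

Lemma subdiv_sym : symmetric subdiv.
Proof. by move=> x y; rewrite /subdiv orbC. Qed.

Lemma subdiv_irr x : ~~ subdiv x x.
Proof.
rewrite /subdiv orbb; case: x => [//|[[v p] j]] /=.
by rewrite (ltn_eqF (ltnSn j)) !andbF.
Qed.

Lemma card_subdiv_inner v p j : #|[set y | subdiv (inr (v, p, j)) y]| <= 3.
Proof.
pose prev : subdiv_vertex :=
  if j == 0 :> nat then inl v else inr (v, p, insubd j j.-1).
pose next : seq subdiv_vertex :=
  if j == len v p :> nat then
    (if nxt v p is Some v' then [:: inl v'] else [::])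
  else [:: inr (v, p, insubd j j.+1)].
apply: (@leq_trans (size (prev :: next))); last first.
  by rewrite /next; case: ifP => // _; case: (nxt v p).
apply: leq_trans (card_size _); apply: subset_leq_card; apply/subsetP => y.
rewrite !inE /subdiv => /orP[]; case: y => [v'|[[v' p'] j']] //=.
- case/andP => /eqP ej /eqP nv; rewrite /next ej eqxx nv mem_seq1.
  by rewrite eqxx orbT.
- case/and4P => /eqP <- /eqP <- /eqP ej' lt_j.
  rewrite /next (ltn_eqF lt_j) mem_seq1; apply/orP; right.
  apply/eqP; congr (inr (_, _, _)); apply/val_inj.
  by rewrite val_insubd -ej' ltn_ord.
- by case/and3P => /eqP -> j0 _; rewrite /prev j0 eqxx.
case/and4P => /eqP -> /eqP -> /eqP ej' lt_j.
rewrite /prev ej' /=; apply/orP; left.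
apply/eqP; congr (inr (_, _, _)); apply/val_inj.
by rewrite val_insubd ltn_ord.
Qed.

Lemma subdiv_lipschitz (phi : V -> nat) v v' k :
  (forall v p v', nxt v p = Some v' ->
     phi v <= phi v' + (len v p).+2 /\ phi v' <= phi v + (len v p).+2) ->
  walk subdiv (inl v) (inl v') k -> phi v' <= phi v + k.
Proof.
move=> lip.
(* On a subdivided edge [phi] is extended by the smaller of the two bounds coming from its ends;
   detached paths get 0. *)
pose psi (x : subdiv_vertex) := match x with
  | inl v => phi v
  | inr (v, p, j) => if nxt v p is Some v' then
      minn (phi v + j.+1) (phi v' + ((len v p).+1 - j)) else 0 end.
suff psi_lip x y : subdiv_step x y -> psi y <= psi x + 1 /\ psi x <= psi y + 1.
  apply: (walk_lipschitz (psi := psi)) => x y.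
  by case/orP => /psi_lip[].
case: x y => [x|[[x p] j]] [y|[[y p'] j']] //=.
- case/and3P => /eqP <- /eqP ->; case nx : (nxt x p') => [z|] // _.
  by have := lip _ _ _ nx; lia.
- case/andP => /eqP -> /eqP nx; rewrite nx.
  by have := lip _ _ _ nx; lia.
- case/and4P => /eqP <- /eqP <- /eqP ->; case nx : (nxt x p) => [z|] //.
  by have := lip _ _ _ nx; lia.
Qed.

Hypothesis W_gt0 : 0 < W.
Hypothesis len_lt : forall v p, len v p < W.

Lemma card_subdiv_outer (ins : V -> seq (V * bool)) v :
  (forall v' p', nxt v' p' = Some v -> (v', p') \in ins v) ->
  size (ins v) + isSome (nxt v true) + isSome (nxt v false) <= 3 ->
  #|[set y | subdiv (inl v) y]| <= 3.
Proof.
move=> insP; apply: leq_trans.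
pose outs p : seq subdiv_vertex :=
  if isSome (nxt v p) then [:: inr (v, p, Ordinal W_gt0)] else [::].
pose inn (vp : V * bool) : subdiv_vertex := inr (vp, Ordinal (len_lt vp.1 vp.2)).
apply: (@leq_trans (size (map inn (ins v) ++ outs true ++ outs false))); last first.
  rewrite !size_cat size_map /outs addnA.
  by case: (nxt v true); case: (nxt v false).
apply: leq_trans (card_size _); apply: subset_leq_card; apply/subsetP => y.
rewrite inE /subdiv !mem_cat => /orP[]; case: y => [v'|[[v' p'] j']] //=.
- case/and3P => /eqP <- /eqP j0 nv; apply/orP; right.
  have -> : j' = Ordinal W_gt0 by apply/val_inj.
  by case: p' nv => nv; rewrite /outs nv mem_seq1 eqxx ?orbT.
- case/andP => /eqP ej /eqP /insP h; apply/orP; left.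
  apply/mapP; exists (v', p') => //; congr (inr (_, _)); exact/val_inj.
Qed.

Lemma walk_subdiv v p v' :
  nxt v p = Some v' -> walk subdiv (inl v) (inl v') (len v p).+2.
Proof.
move=> nv; have inner j : forall lt_j : j < W, j <= len v p ->
    walk subdiv (inl v) (inr (v, p, Ordinal lt_j)) j.+1.
  elim: j => [|j IH] lt_j le_j.
    by apply: walk1; rewrite /subdiv /= eqxx nv.
  have lt_j' := ltn_trans (ltnSn j) lt_j.
  rewrite -(addn1 j.+1); apply: walk_trans (IH lt_j' (ltnW le_j)) _.
  by apply: walk1; rewrite /subdiv /= !eqxx le_j.
rewrite -addn1; apply: walk_trans (inner _ (len_lt v p) (leqnn _)) _.
by apply: walk1; rewrite /subdiv /= nv !eqxx.
Qed.

End Subdivision.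

(** * Placing a graph on the vertex set ['I_n] *)

Section Embedding.
Variables (U : finType) (e : rel U) (n : nat) (leUn : #|U| <= n).

Definition embed_vertex (u : U) : 'I_n := widen_ord leUn (enum_rank u).

Definition embed_inv (i : 'I_n) : option U :=
  omap enum_val (insub (i : nat) : option 'I_#|U|).

(** Ordinals outside the image of [U] are isolated vertices, which pad the graph to exactly [n]
    vertices. *)
Definition embed_graph : rel 'I_n := fun i j =>
  if (embed_inv i, embed_inv j) is (Some u, Some v) then e u v else false.

Lemma embed_vertexK : pcancel embed_vertex embed_inv.
Proof.
move=> u; rewrite /embed_inv /= insubT ?ltn_ord // => h /=.
by congr Some; rewrite -[RHS]enum_rankK; congr enum_val; apply/val_inj.
Qed.

Lemma embed_invK : ocancel embed_inv embed_vertex.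
Proof.
move=> i; rewrite /embed_inv; case: insubP => //= k _ ki.
by apply/val_inj; rewrite /= enum_valK.
Qed.

Lemma embed_graph_maxdeg3 : symmetric e -> (forall u, ~~ e u u) ->
  (forall u, #|[set v | e u v]| <= 3) -> maxdeg3_graph embed_graph.
Proof.
move=> esym eirr edeg; apply/and3P; split.
- apply/forallP => i; rewrite /embed_graph.
  by case: (embed_inv i).
- apply/forallP => i; apply/forallP => j; rewrite /embed_graph.
  by case: (embed_inv i) (embed_inv j) => [u|] [v|] //; rewrite esym.
- apply/forallP => i; rewrite /embed_graph.
  case: (embed_inv i) => [u|]; last by rewrite (eq_card0 _) // => j; rewrite inE.
  apply: leq_trans (edeg u); apply: leq_trans (leq_imset_card embed_vertex _).
  apply: subset_leq_card; apply/subsetP => j; rewrite inE.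
  have := embed_invK j; case: (embed_inv j) => [v /= <- uv|//].
  by apply/imsetP; exists v; rewrite ?inE.
Qed.

Lemma walk_embed u v k :
  walk embed_graph (embed_vertex u) (embed_vertex v) k <-> walk e u v k.
Proof.
split=> [[p []]|[p [pp <- <-]]]; last first.
  exists (map embed_vertex p); rewrite last_map size_map path_map; split=> //.
  by apply: sub_path pp => x y xy; rewrite /= /embed_graph !embed_vertexK.
elim: p u k => [|i p IH] u k /=.
  by move=> _ /(pcan_inj embed_vertexK) <- <-; exact: walk0.
case/andP; rewrite {1}/embed_graph embed_vertexK.
have := embed_invK i; case: (embed_inv i) => [w /= <- uw pp pl <-|//].
by rewrite -add1n; apply: walk_trans (walk1 uw) (IH _ _ pp pl _).
Qed.

End Embedding.

(** * The layered grid graph and its distances *)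

Lemma leq_sum_at (I : finType) (i0 : I) (f g : I -> nat) k :
  (forall i, i != i0 -> f i = g i) -> f i0 <= g i0 + k ->
  \sum_i f i <= \sum_i g i + k.
Proof.
move=> fg le0; rewrite (bigD1 i0) //= [X in _ <= X + k](bigD1 i0) //=.
by rewrite (eq_bigr g) => [|i /fg //]; lia.
Qed.

Section Grid.
Variables l m : nat.

Definition coords := {ffun 'I_l.+1 -> 'I_m.+1}.
Definition upd (w : coords) c r : coords :=
  [ffun i => if i == c then r else w i].

(* In [(sd, c, w, r, h)], [sd] is the side (right if true), coordinate [c] of
   [w] is being replaced by a new value, for which [r] is the current candidate.
   The gadget of [c] is a pair of grids: if [h] holds, [r] can be incremented at
   a price depending on the old value [w c]; otherwise [r] is final and the old
   value is counted down to 0, which keeps all degrees at most 3. *)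
Definition grid_vertex : finType :=
  (bool * 'I_l.+1 * coords * 'I_m.+1 * bool)%type.

Variable S : pred coords.

Definition grid_next (v : grid_vertex) (p : bool) : option grid_vertex :=
  let: (sd, c, w, r, h) := v in
  if h then
    if p then
      if r < m then Some (sd, c, w, inord r.+1, true) else None
    else Some (sd, c, w, r, false)
  else if p then
    if 0 < w c then Some (sd, c, upd w c (inord (w c).-1), r, false)
    else if c < l then Some (sd, inord c.+1, upd w c r, ord0, true)
    else if ~~ sd && S (upd w c r) then Some (true, c, w, r, false) else None
  else None.

(** The term [(m - r) * (4 * m + 2)] cancels the part of the price of reaching column [r] that is
    linear in [r] and free of the old value. *)
Definition commit_len (r : nat) := r * r + (m - r) * (4 * m + 2).

(** The middle edge pays the commitment of the last coordinate for both sides, hence the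
    doubling. *)
Definition grid_len (v : grid_vertex) (p : bool) : nat :=
  let: (sd, c, w, r, h) := v in
  if h then (if p then 4 * (m - w c) else 0)
  else if 0 < w c then 2 * m
  else if c < l then commit_len r else (commit_len r).*2 + 2.

Lemma grid_len_lt v p : grid_len v p < 16 * m.+1 ^ 2.
Proof.
case: v => [[[[sd c] w] r] h]; rewrite /= /commit_len.
have := ltn_ord r; have := ltn_ord (w c); move: (w c : nat) (r : nat) => a b.
move=> lea leb.
have h1 : b * b <= m * m by apply: leq_mul; lia.
have h2 : (m - b) * (4 * m + 2) <= m * (4 * m + 2) by apply: leq_mul; lia.
by case: h; case: p => /=; do ?case: ifP => _; nia.
Qed.

(* The listed incoming edges need not all exist: [inord] of an out-of-range
   value is junk, which is harmless in an upper bound on the degree. *)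
Definition grid_ins (v : grid_vertex) : seq (grid_vertex * bool) :=
  let: (sd, c, w, r, h) := v in
  if h then
    if 0 < r then [:: ((sd, c, w, inord r.-1, true), true)]
    else let c' := inord c.-1 in
      [:: ((sd, c', upd w c' ord0, w c', false), true)]
  else [:: ((sd, c, w, r, true), false);
           ((sd, c, upd w c (inord (w c).+1), r, false), true)] ++
       (if [&& sd, c == l :> nat & w c == 0 :> nat]
        then [:: ((false, c, w, r, false), true)] else [::]).

Lemma upd_upd w c r r' : upd (upd w c r) c r' = upd w c r'.
Proof. by apply/ffunP => i; rewrite !ffunE; case: eqP. Qed.

Lemma upd_id w c : upd w c (w c) = w.
Proof. by apply/ffunP => i; rewrite ffunE; case: eqP => [->|]. Qed.

Lemma updE w c r : upd w c r c = r.
Proof. by rewrite ffunE eqxx. Qed.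

Lemma grid_insP v' p' v : grid_next v' p' = Some v -> (v', p') \in grid_ins v.
Proof.
case: v' => [[[[sd c] w] r] h]; have lec := ltn_ord c; case: h; case: p' => //=.
- case: ifP => // lt_r [<-] /=; rewrite inordK //= mem_seq1.
  by rewrite inord_val.
- by case=> <- /=; rewrite mem_head.
case: ifP => [w_gt0 [<-]|w0] /=.
  rewrite updE inordK ?(leq_ltn_trans (leq_pred _)) // prednK // inord_val.
  by rewrite upd_upd upd_id !inE eqxx orbT.
have wc : w c = ord0 by apply/val_inj => /=; lia.
case: ifP => [lt_c [<-]|ge_c] /=.
  rewrite inordK //= inord_val updE upd_upd.
  by rewrite -wc upd_id mem_head.
case: ifP => // /andP[sd0 _] [<-] /=; rewrite wc.
have -> : c = l :> nat by lia.
by rewrite eqxx /= (negbTE sd0) !inE eqxx !orbT.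
Qed.

Lemma grid_deg v : size (grid_ins v) + isSome (grid_next v true)
  + isSome (grid_next v false) <= 3.
Proof.
case: v => [[[[sd c] w] r] h]; have lec := ltn_ord c; case: h => /=.
  by case: ifP => _; case: ifP => _.
case: (posnP (w c)) => [w0|_]; last by rewrite !andbF.
case: ltnP => ltc /=; first by rewrite (ltn_eqF ltc) !andbF.
have -> : c = l :> nat by lia.
by case: sd; rewrite eqxx //=; case: ifP.
Qed.

(* [before x a r] bounds from below the distance, in the gadget of one
   coordinate, from its entry in row [x] to row [a] and column [r]; the columns
   are expensive enough for it not to pay to visit cheaper rows first. *)
Definition before (x a r : nat) :=
  r * (4 * (m - maxn x a) + 2) + (2 * m + 2) * ((a - x) + (x - a)).
(** The whole price of replacing [x] by [y]: the 4 is the weight 2 of the edge that switches [h] and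
    the 2 that the weight of the exit edge has beyond [commit_len]. *)
Definition after (x y : nat) := before x 0 y + commit_len y + 4.

(** The cases are a coordinate already replaced, in progress, and not yet reached. The last kind may
    differ from [x i], since a walk can turn back. *)
Definition pot_at (x : coords) (v : grid_vertex) (i : 'I_l.+1) :=
  let: (sd, c, w, r, h) := v in
  if i < c then after (x i) (w i)
  else if i == c then before (x i) (w i) r + (~~ h) * 2
  else before (x i) (w i) 0.
(* Every edge inside a side changes the state of one coordinate only, so the
   bounds for the single coordinates add up. *)
Definition pot x v := \sum_i pot_at x v i.

Lemma pot_lipschitz x v p v' : grid_next v p = Some v' ->
  pot x v <= pot x v' + (grid_len v p).+2 /\
  pot x v' <= pot x v + (grid_len v p).+2.
Proof.
case: v => [[[[sd c] w] r] h]; have lec := ltn_ord c.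
have lex := ltn_ord (x c); have lew := ltn_ord (w c); have ler := ltn_ord r.
case: h; case: p => //=.
- case: ifP => // lt_r [<-]; split; apply: (@leq_sum_at _ c) => [i nic|] /=;
    rewrite ?(negbTE nic) // ltnn eqxx /before inordK //; nia.
- case=> <-; split; apply: (@leq_sum_at _ c) => [i nic|] /=;
    rewrite ?(negbTE nic) // ltnn eqxx /before; lia.
case: ifP => [w_gt0 [<-]|w0] /=.
  split; apply: (@leq_sum_at _ c) => [i nic|] /=;
    rewrite ?ffunE ?(negbTE nic) // ltnn eqxx /before
            ?inordK ?(leq_ltn_trans (leq_pred _)) //; nia.
have wc : w c = ord0 by apply/val_inj => /=; lia.
case: ifP => [lt_c [<-]|ge_c] /=.
  (* Entering the next gadget in column 0 leaves the term of that coordinate as it was while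
     unreached. *)
  have same i : i != c ->
    pot_at x (sd, c, w, r, false) i =
    pot_at x (sd, inord c.+1, upd w c r, ord0, true) i.
    move=> nic; rewrite /= ffunE (negbTE nic) inordK // ltnS [i <= c]leq_eqVlt.
    rewrite (negbTE nic : (i == c :> nat) = false) /=.
    by case: ifP => // _; case: ifP => //= _; rewrite addn0.
  split; apply: (@leq_sum_at _ c) => [i /same //|] /=.
    rewrite ltnn eqxx inordK // ltnSn /after updE wc /=; lia.
  rewrite ltnn eqxx inordK // ltnSn /after updE wc /=; lia.
(* [pot] ignores the side, so it is constant across the middle edge. *)
case: ifP => // _ [<-]; split; apply: leq_addr.
Qed.

(** What the last coordinate still owes at the middle layer is half the weight of the middle
    edge. *)
Lemma pot_exit x sd (c : 'I_l.+1) (w : coords) r : c = l :> nat -> w c = ord0 ->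
  pot x (sd, c, w, r, false) + (commit_len r + 2) =
  \sum_i after (x i) (upd w c r i).
Proof.
move=> cl wc; rewrite /pot (bigD1 c) //= [RHS](bigD1 c) //= ltnn eqxx updE wc.
rewrite /after /=; set A := \sum_(i < _ | _) _; set B := \sum_(i < _ | _) _.
suff -> : A = B by lia.
apply: eq_bigr => i nic; rewrite ffunE (negbTE nic).
suff -> : i < c by [].
by move: nic; rewrite -val_eqE /=; have := ltn_ord i; lia.
Qed.

Definition start (sd : bool) (x : coords) : grid_vertex :=
  (sd, ord0, x, ord0, true).

Lemma pot_start x sd : pot x (start sd x) = 0.
Proof.
apply: big1 => i _; rewrite /= /before.
by case: eqP => [->|]; rewrite subnn muln0.
Qed.

Definition route_cost (x z y : coords) :=
  \sum_i (after (x i) (y i) + after (z i) (y i)).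

Lemma grid_walk_geq x z T k :
  (forall y, S y -> T <= route_cost x z y) ->
  walk (@subdiv _ (16 * m.+1 ^ 2) grid_next grid_len)
    (inl (start false x)) (inl (start true z)) k -> T <= k.
Proof.
move=> leT.
(* Left of the middle layer the distance from [x] is bounded below by [pot x],
   right of it also by [T] minus the bound [pot z] on the distance to [z]. *)
pose phi (v : grid_vertex) :=
  if v.1.1.1.1 then maxn (pot x v) (T - pot z v) else pot x v.
suff lip v p v' : grid_next v p = Some v' ->
    phi v <= phi v' + (grid_len v p).+2 /\ phi v' <= phi v + (grid_len v p).+2.
  move/(subdiv_lipschitz lip); rewrite /phi /= !pot_start subn0.
  by move=> h; apply: leq_trans h; apply: leq_maxr.
move=> nv; have [x1 x2] := pot_lipschitz x nv; have [z1 z2] := pot_lipschitz z nv.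
rewrite /phi; have [<-|] := eqVneq v.1.1.1.1 v'.1.1.1.1.
  by case: ifP => _; lia.
case: v nv x1 x2 z1 z2 => [[[[sd c] w] r] h]; have lec := ltn_ord c.
rewrite /=; case: h; case: p => //=.
- by case: ifP => // _ [<-]; rewrite eqxx.
- by case=> <-; rewrite eqxx.
case: ifP => [_ [<-]|w0]; first by rewrite eqxx.
case: ifP => [_ [<-]|ge_c]; first by rewrite eqxx.
case: ifP => // /andP[/negbTE -> Sy] [<-] /= _ _ _ _ _.
have cl : c = l :> nat by lia.
have wc : w c = ord0 by apply/val_inj => /=; lia.
(* By [pot_exit] the two potentials and the weight of the middle edge sum to [route_cost x z y],
   which is at least [T]. *)
have := leT _ Sy; rewrite /route_cost big_split /=.
by rewrite -!(pot_exit _ false r cl wc); rewrite /pot /=; lia.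
Qed.

Notation gwalk u v := (walk (@subdiv _ (16 * m.+1 ^ 2) grid_next grid_len)
  (inl (u : grid_vertex)) (inl (v : grid_vertex))).

Lemma gwalk1 v p v' : grid_next v p = Some v' -> gwalk v v' (grid_len v p).+2.
Proof. exact: (walk_subdiv grid_len_lt). Qed.

Lemma gwalk_row sd c w (r : 'I_m.+1) :
  gwalk (sd, c, w, ord0, true) (sd, c, w, r, true) (r * (4 * (m - w c) + 2)).
Proof.
have le_r := ltn_ord r; rewrite -[X in gwalk _ (sd, c, w, X, true)]inord_val.
elim: (r : nat) le_r => [|j IH] ltj.
  have -> : inord 0 = ord0 :> 'I_m.+1 by apply/val_inj; rewrite /= inordK.
  exact: walk0.
rewrite [j.+1 * _]mulSnr; apply: walk_trans (IH (ltnW ltj)) _.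
rewrite addn2; apply: (@gwalk1 _ true) => /=.
by rewrite inordK ?(ltnW ltj) // -ltnS ltj.
Qed.

Lemma gwalk_column sd c w r :
  gwalk (sd, c, w, r, false) (sd, c, upd w c ord0, r, false)
    ((2 * m + 2) * w c).
Proof.
move E: (w c : nat) => a; elim: a w E => [|a IH] w E.
  have <- : w c = ord0 by apply/val_inj.
  by rewrite upd_id muln0; exact: walk0.
have lt_a : a < m.+1 by rewrite -E in IH *; have := ltn_ord (w c); lia.
rewrite mulnS; have := IH (upd w c (inord a)); rewrite updE inordK // upd_upd.
move=> /(_ erefl); apply: walk_trans.
have -> : 2 * m + 2 = (grid_len (sd, c, w, r, false) true).+2.
  by rewrite /= E addn2.
by apply: gwalk1; rewrite /= E.
Qed.

(** All increments are made in the row of the old value, and only then is that value counted down;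
    this attains the bound [before]. *)
Lemma gwalk_gadget sd c w r :
  gwalk (sd, c, w, ord0, true) (sd, c, upd w c ord0, r, false)
    (before (w c) 0 r + 2).
Proof.
rewrite /before maxn0 sub0n add0n subn0 addnAC.
apply: walk_trans (gwalk_column _ _ _ _).
apply: walk_trans (gwalk_row _ _ _ _) _.
exact: (@gwalk1 (sd, c, w, r, true) false).
Qed.

Lemma gwalk_half sd (x y : coords) k : k <= l ->
  gwalk (start sd x)
    (sd, inord k, [ffun i : 'I_l.+1 => if i < k then y i else x i], ord0, true)
    (\sum_(i < l.+1 | i < k) after (x i) (y i)).
Proof.
elim: k => [|k IH] le_k.
  rewrite big_pred0 //; have -> : inord 0 = ord0 :> 'I_l.+1.
    by apply/val_inj; rewrite /= inordK.
  have -> : [ffun i : 'I_l.+1 => if i < 0 then y i else x i] = x.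
    by apply/ffunP => i; rewrite ffunE.
  exact: walk0.
have ltk : k < l.+1 by lia.
set c : 'I_l.+1 := inord k; have ck : c = k :> nat by rewrite /c inordK.
rewrite (bigD1 c) ?ck //= addnC.
rewrite (eq_bigl (fun i : 'I_l.+1 => i < k)); last first.
  by move=> i; rewrite -val_eqE /= ck; lia.
apply: walk_trans (IH (ltnW le_k)) _.
rewrite /after -/c; set w := [ffun i => _].
have wc : w c = x c by rewrite ffunE ck ltnn.
rewrite -wc.
have -> : before (w c) 0 (y c) + commit_len (y c) + 4 =
  before (w c) 0 (y c) + 2 + (commit_len (y c)).+2 by lia.
apply: walk_trans (gwalk_gadget _ _ _ _) _.
set w' := [ffun i => _]; pose u : grid_vertex := (sd, c, upd w c ord0, y c, false).
have -> : commit_len (y c) = grid_len u true by rewrite /= updE /= ck le_k.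
apply: gwalk1; rewrite /= updE /= ck le_k upd_upd.
congr (Some (_, _, _, _, _)); apply/ffunP => i; rewrite !ffunE -val_eqE /= ck.
rewrite ltnS [i <= k]leq_eqVlt; case: eqP => //= ik.
by congr (y _); apply/val_inj; rewrite /= ck.
Qed.

Lemma grid_walk x z y : S y ->
  gwalk (start false x) (start true z) (route_cost x z y).
Proof.
move=> Sy; pose w := upd y ord_max ord0.
pose u sd : grid_vertex := (sd, ord_max, w, y ord_max, false).
pose half (x0 : coords) := \sum_(i < l.+1 | i < l) after (x0 i) (y i)
  + (before (x0 ord_max) 0 (y ord_max) + 2).
have hw sd x0 : gwalk (start sd x0) (u sd) (half x0).
  apply: walk_trans (gwalk_half sd x0 y (leqnn l)) _.
  have -> : inord l = ord_max :> 'I_l.+1 by apply/val_inj; rewrite /= inordK.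
  set w0 := [ffun i => _].
  have -> : x0 ord_max = w0 ord_max by rewrite ffunE ltnn.
  rewrite /u; have -> : w = upd w0 ord_max ord0; last exact: gwalk_gadget.
  apply/ffunP => i; rewrite !ffunE; case: eqVneq => // ni.
  suff -> : i < l by [].
  by rewrite ltn_neqAle -[i <= l]ltnS ltn_ord andbT.
have -> : route_cost x z y =
    half x + ((commit_len (y ord_max)).*2 + 2).+2 + half z.
  rewrite /route_cost big_split /= (bigD1 ord_max) //=.
  rewrite [X in _ + X](bigD1 ord_max) //= /half.
  have E : (fun i : 'I_l.+1 => i != ord_max) =1 (fun i : 'I_l.+1 => i < l).
    by move=> i; rewrite ltn_neqAle -[i <= l]ltnS ltn_ord andbT.
  rewrite !(eq_bigl _ _ E) [after (x ord_max) _]/after [after (z ord_max) _]/after.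
  set A := \sum_(i < _ | _) _; set B := \sum_(i < _ | _) _.
  by lia.
apply: walk_trans (walk_sym (@subdiv_sym _ _ _ _) (hw true z)).
apply: walk_trans (hw false x) _.
have -> : (commit_len (y ord_max)).*2 + 2 = grid_len (u false) true.
  by rewrite /= updE /= ltnn.
by apply: gwalk1; rewrite /= updE /= ltnn upd_upd upd_id Sy.
Qed.

End Grid.

(** * The cheapest crossing is [x + z] *)

(** With [4 * x * y] moved to the left, the right side is [y * y] plus terms independent of [y]. *)
Lemma afterE m x y : x <= m -> y <= m ->
  after m x y + 4 * x * y = y * y + (2 * m + 2) * x + m * (4 * m + 2) + 4.
Proof.
move=> lex ley; rewrite /after /before /commit_len maxn0 sub0n subn0 add0n.
rewrite -{2 3 4 5 6 7}(subnKC lex); nia.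
Qed.

(* By [afterE] the sum is [2 (y - (x + z))^2] up to terms independent of [y]. *)
Lemma after_min m x z y : x + z <= m -> y <= m ->
  after m x (x + z) + after m z (x + z) + (y != x + z) <=
  after m x y + after m z y.
Proof.
move=> lexz ley.
have lex : x <= m by lia.
have lez : z <= m by lia.
have := afterE lex lexz; have := afterE lez lexz.
have := afterE lex ley; have := afterE lez ley.
by case: (ltngtP y (x + z)) => [lt|gt|->] /=; nia.
Qed.

Section RouteCost.
Variables l m : nat.
Implicit Types x y z : coords l m.

Lemma route_cost_lt x z y0 y : (forall i, y0 i = x i + z i :> nat) ->
  y != y0 -> route_cost x z y0 < route_cost x z y.
Proof.
move=> y0E ny; have leo (i : 'I_m.+1) : i <= m by rewrite -ltnS.
have [i nyi] : exists i, y i != y0 i.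
  apply/existsP; apply: contraR ny => /existsPn eqy.
  by apply/eqP/ffunP => i; have := eqy i; rewrite negbK => /eqP.
(* Every coordinate where [y] differs from [y0] costs at least 1 more. *)
apply: (@leq_trans (route_cost x z y0 + \sum_i (y i != y0 i))).
  by rewrite -addn1 leq_add2l (bigD1 i) //= nyi.
rewrite -big_split; apply: leq_sum => j _ /=.
rewrite -val_eqE /= y0E; apply: after_min => //.
by rewrite -y0E.
Qed.

(** Keeps the intended walk shorter than [n], within the range that [dist] searches. *)
Lemma route_cost_leq x z y : route_cost x z y <= l.+1 * (16 * m.+1 ^ 2).
Proof.
rewrite -mulnn -[X in X * _]card_ord -sum_nat_const; apply: leq_sum => i _.
have leo (j : 'I_m.+1) : j <= m by rewrite -ltnS.
have := afterE (leo (x i)) (leo (y i)); have := afterE (leo (z i)) (leo (y i)).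
have := leo (x i); have := leo (y i); have := leo (z i); nia.
Qed.

End RouteCost.

(** * Reading a bit off a distance *)

Section GridGraph.
Variables l m n : nat.

Definition grid_subdiv : finType :=
  subdiv_vertex (grid_vertex l m) (16 * m.+1 ^ 2).

Lemma card_grid_subdiv : #|grid_subdiv| =
  (2 * l.+1 * m.+1 ^ l.+1 * m.+1 * 2) * (1 + 2 * (16 * m.+1 ^ 2)).
Proof.
rewrite card_sum !card_prod card_ffun card_bool !card_ord; lia.
Qed.

Hypothesis card_leq : #|grid_subdiv| <= n.

Definition grid_graph (S : pred (coords l m)) : rel 'I_n :=
  embed_graph (subdiv (grid_next S) (@grid_len l m) : rel grid_subdiv) (n := n).

Definition grid_start (sd : bool) (x : coords l m) : 'I_n :=
  embed_vertex card_leq (inl (start sd x)).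

Lemma grid_graph_maxdeg3 S : maxdeg3_graph (grid_graph S).
Proof.
apply: (embed_graph_maxdeg3 card_leq).
- exact: subdiv_sym.
- exact: subdiv_irr.
case=> [v|[[v p] j]]; last exact: card_subdiv_inner.
apply: (@card_subdiv_outer _ _ _ _ _ _ (@grid_ins l m)) => //.
- exact: grid_len_lt.
- by move=> v' p'; apply: grid_insP.
- exact: grid_deg.
Qed.

(** If the bit is set, the crossing at [y0] gives a walk of the stated length; otherwise every
    available crossing differs from [y0] and is strictly dearer. *)
Lemma dist_grid_graph S (x z y0 : coords l m) : (forall i, y0 i = x i + z i :> nat) ->
  (if Defs.dist (grid_graph S) (grid_start false x) (grid_start true z)
     is Some k then k <= route_cost x z y0 else false) = S y0.
Proof.
move=> y0E; case Sy: (S y0).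
  have lt_n : route_cost x z y0 < n.
    apply: leq_trans card_leq; rewrite card_grid_subdiv.
    apply: leq_ltn_trans (route_cost_leq _ _ _) _.
    have : 0 < m.+1 ^ l.+1 by rewrite expn_gt0.
    move: (m.+1 ^ l.+1) (m.+1 ^ 2) => a b a_gt0; nia.
  have /(walk_embed _ card_leq) w := grid_walk x z Sy.
  by have [k -> ->] := walk_dist_leq w lt_n.
case E: (Defs.dist _ _ _) => [k|//]; apply/negbTE; rewrite -ltnNge.
move/dist_Some_walk/walk_embed: E; apply: grid_walk_geq => y Sy'.
by apply: route_cost_lt => //; apply: contraTneq Sy' => ->; rewrite Sy.
Qed.

End GridGraph.

(** * Digits and the Sum-Index protocol *)

Section Digits.
Variable q : nat.
Hypothesis q_gt0 : 0 < q.

Definition digit i a := (a %/ q ^ i) %% q.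

Lemma sum_digits k a : \sum_(i < k) digit i a * q ^ i = a %% q ^ k.
Proof.
elim: k => [|k IH]; first by rewrite big_ord0 modn1.
rewrite big_ord_recr /= IH /digit expnS.
have qk : 0 < q ^ k by rewrite expn_gt0 q_gt0.
have aE : a = a %/ q ^ k %/ q * (q * q ^ k) +
    (a %% q ^ k + (a %/ q ^ k) %% q * q ^ k).
  by rewrite {1}(divn_eq a (q ^ k)) {1}(divn_eq (a %/ q ^ k) q); lia.
rewrite [in RHS]aE modnMDl [RHS]modn_small //.
apply: (@leq_trans (((a %/ q ^ k) %% q).+1 * q ^ k)).
  by rewrite mulSn ltn_add2r ltn_pmod.
by rewrite leq_mul2r ltn_pmod ?orbT.
Qed.

End Digits.

Lemma sumindex_ub_finType (M : finType) n k
    (A B : n.-tuple bool -> 'I_n -> M) (R : M -> M -> bool) :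
  (forall S a b, R (A S a) (B S b) = nth false S ((a + b) %% n)) ->
  #|M| <= 2 ^ k -> sumindex_ub n k.
Proof.
move=> RP leM; have leT : #|M| <= #|{: k.-tuple bool}|.
  by rewrite card_tuple card_bool.
pose enc (x : M) : k.-tuple bool := enum_val (embed_vertex leT x).
pose dec (s : seq bool) : option M :=
  obind (fun t : k.-tuple bool => embed_inv M (enum_rank t)) (insub s).
have encK x : dec (enc x) = Some x.
  by rewrite /dec valK /= enum_valK embed_vertexK.
exists (fun S a => enc (A S a)), (fun S b => enc (B S b)).
exists (fun s s' => if (dec s, dec s') is (Some x, Some y) then R x y else false).
split=> [S a b|]; first by rewrite !encK.
by split=> S a; rewrite size_tuple.
Qed.

Lemma card_bseq_bool_leq k : #|{bseq k of bool}| <= 2 ^ k.+1.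
Proof.
rewrite card_bseq card_bool; elim: k => [|k IH]; first by rewrite big_ord1.
by rewrite big_ord_recr /= [2 ^ k.+2]expnS mul2n -addnn leq_add2r.
Qed.

Section Protocol.
Variables l m q n K : nat.
Hypothesis q_gt0 : 0 < q.
Hypothesis digits_fit : q + q <= m.+2.
Hypothesis card_leq : #|grid_subdiv l m| <= n.
Hypothesis n_leq : n <= K * q ^ l.+1.

Definition digits a : coords l m := [ffun i : 'I_l.+1 => inord (digit q i a)].
Definition add_coords (x z : coords l m) : coords l m :=
  [ffun i => inord (x i + z i)].
(** Entries of [y] may exceed [q - 1], so the index can run past its block; it is read cyclically
    modulo [n]. *)
Definition block (S : n.-tuple bool) (c : nat) : pred (coords l m) :=
  fun y => nth false S ((c * q ^ l.+1 + \sum_i y i * q ^ i) %% n).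

Lemma digitsE a (i : 'I_l.+1) : digits a i = digit q i a :> nat.
Proof.
rewrite ffunE inordK //; have := ltn_pmod (a %/ q ^ i) q_gt0.
rewrite /digit; lia.
Qed.

Lemma add_digitsE a b (i : 'I_l.+1) :
  add_coords (digits a) (digits b) i = digits a i + digits b i :> nat.
Proof.
rewrite ffunE inordK // !digitsE.
have := ltn_pmod (a %/ q ^ i) q_gt0; have := ltn_pmod (b %/ q ^ i) q_gt0.
rewrite /digit; lia.
Qed.

Lemma block_digits S a b :
  block S (a %/ q ^ l.+1 + b %/ q ^ l.+1) (add_coords (digits a) (digits b)) =
  nth false S ((a + b) %% n).
Proof.
rewrite /block; congr (nth _ _ (_ %% _)).
under eq_bigr => i _ do rewrite add_digitsE !digitsE mulnDl.
rewrite big_split /= !sum_digits // {3}(divn_eq a (q ^ l.+1)).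
by rewrite {3}(divn_eq b (q ^ l.+1)); lia.
Qed.

(** Neither player knows the block number [a %/ Q + b %/ Q], so each sends its own index and one
    label per block graph, and the referee selects. The left side of the last hypothesis bounds the
    number of such messages. *)
Lemma sumindex_ub_of_labeling f label L k :
  is_distance_labeling_scheme f label ->
  (forall (G : rel 'I_n) v, maxdeg3_graph G -> size (label G v) <= L) ->
  n * (2 ^ L.+1) ^ (K.*2).+1 <= 2 ^ k -> sumindex_ub n k.
Proof.
move=> scheme leL lek.
pose Q := q ^ l.+1; have Q_gt0 : 0 < Q by rewrite expn_gt0 q_gt0.
pose G S (c : nat) : rel 'I_n := grid_graph (block S c).
pose msg sd S (a : 'I_n) : 'I_n * {ffun 'I_(K.*2).+1 -> {bseq L of bool}} :=
  (a, [ffun c : 'I__ => insub_bseq L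
         (label (G S c) (grid_start card_leq sd (digits a)))]).
pose R (u v : 'I_n * {ffun 'I_(K.*2).+1 -> {bseq L of bool}}) :=
  let c := inord (u.1 %/ Q + v.1 %/ Q) in
  let x := digits u.1 in let z := digits v.1 in
  if f (u.2 c) (v.2 c) is Some j then j <= route_cost x z (add_coords x z)
  else false.
apply: (@sumindex_ub_finType _ n k (msg false) (msg true) R) => [S a b|].
  have Gdeg c : maxdeg3_graph (G S c) by apply: grid_graph_maxdeg3.
  have lt_c : a %/ Q + b %/ Q < (K.*2).+1.
    have lt_K (i : 'I_n) : i %/ Q < K.
      by rewrite ltn_divLR //; apply: leq_trans (ltn_ord i) n_leq.
    by have := lt_K a; have := lt_K b; lia.
  have insubE sd x : insub_bseq L (label (G S x) sd) = label (G S x) sd :> seq bool.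
    by rewrite /insub_bseq [bseqval _]val_insubd leL.
  rewrite /R /= !ffunE !insubE.
  rewrite scheme // inordK // dist_grid_graph; last exact: add_digitsE.
  exact: block_digits.
apply: leq_trans lek; rewrite card_prod card_ffun !card_ord leq_mul2l.
by rewrite leq_exp2r ?card_bseq_bool_leq ?orbT.
Qed.

End Protocol.

(** * Choice of parameters *)

Section PowersOfTwo.
Variable l : nat.
Let t := l.+1.
Let m := (2 ^ t.+1).-1.

Lemma card_grid_subdiv_pow2 : #|grid_subdiv l m| <= 2 ^ (t * (t + 16)).
Proof.
have m1 : m.+1 = 2 ^ t.+1 by rewrite prednK ?expn_gt0.
rewrite card_grid_subdiv m1 -/t -!expnM.
(* The exponents add up to [t^2 + 5t + 11], at most [t * (t + 16)] because [t >= 1]. *)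
apply: (@leq_trans (2 ^ (t + 2 + t.+1 * t + t.+1) * 2 ^ (6 + t.+1 * 2))).
  apply: leq_mul.
    rewrite !expnD; have := ltn_expl t (ltnSn 1).
    by move: (2 ^ t) (2 ^ (t.+1 * t)) (2 ^ t.+1) => a b c; nia.
  by rewrite expnD; have := expn_gt0 2 (t.+1 * 2); lia.
by rewrite -expnD leq_exp2l //; rewrite /t; nia.
Qed.

Lemma SumIndex_leq f label L :
  is_distance_labeling_scheme (n := 2 ^ (t * (t + 16))) f label ->
  (forall (G : rel 'I__) v, maxdeg3_graph G -> size (label G v) <= L) ->
  0 < L -> SumIndex (2 ^ (t * (t + 16))) <= 2 ^ (19 * t) * L.
Proof.
move=> scheme leL L_gt0; rewrite /SumIndex; case: ex_minnP => k _; apply.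
apply/pdecP.
(* [K] is [n] divided by [q^t = 2^(t^2)]. *)
apply: (sumindex_ub_of_labeling (l := l) (m := m) (q := 2 ^ t)
  (K := 2 ^ (16 * t)) _ _ card_grid_subdiv_pow2 _ scheme leL).
- by rewrite expn_gt0.
- by rewrite addnn -mul2n -expnS -/t /m; lia.
- by rewrite -expnM -expnD -/t; apply: eq_leq; congr (2 ^ _); lia.
rewrite -expnM -expnD leq_exp2l //.
have -> : 19 * t = 3 * t + 16 * t by lia.
rewrite expnD.
have le_t : t * (t + 16) <= 2 ^ (16 * t).
  apply: (@leq_trans (2 ^ t * 2 ^ (t + 4))).
    apply: leq_mul; first exact: ltnW (ltn_expl _ _).
    by rewrite expnD; have := ltn_expl t (ltnSn 1); lia.
  by rewrite -expnD leq_exp2l //; lia.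
have : 2 ^ 3 <= 2 ^ (3 * t) by rewrite leq_exp2l //; lia.
have : 0 < 2 ^ (16 * t) by rewrite expn_gt0.
move: le_t; move: (t * _) (2 ^ (16 * t)) (2 ^ (3 * t)) => u K c le_u K_gt0 le_c.
(* As [L >= 1], the message length is at most [K + 2L * 3K <= 8KL], and [8 <= 2^(3t)]; thus 19 = 16
   + 3. *)
apply: (@leq_trans (8 * K * L)); first by rewrite -muln2; nia.
by rewrite !leq_mul2r le_c !orbT.
Qed.

End PowersOfTwo.

(* Two vertices of an edgeless graph cannot carry the same label. *)
Lemma label_nonempty n f label : 1 < n ->
  is_distance_labeling_scheme (n := n) f label ->
  exists (G : rel 'I_n) v, maxdeg3_graph G /\ 0 < size (label G v).
Proof.
move=> n_gt1 scheme; pose G : rel 'I_n := fun _ _ => false.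
have Gdeg : maxdeg3_graph G.
  apply/and3P; split; apply/forallP => u //; first by apply/forallP.
  by rewrite (eq_card0 _) // => v; rewrite inE.
exists G; pose u := Ordinal (ltnW n_gt1); pose v := Ordinal n_gt1.
case: (posnP (size (label G u))) => [/size0nil lu|]; last by exists u.
exists v; split=> //; rewrite lt0n size_eq0; apply/eqP => lv.
have [[|k] duu //] := walk_dist_leq (walk0 G u) (ltnW n_gt1) => _.
have /dist_Some_walk [p [_ pl /size0nil p0]] : Defs.dist G u v = Some 0.
  by rewrite -scheme // lv -lu scheme.
by move: pl; rewrite p0.
Qed.

(** * Real exponents and the conclusion *)

Lemma INR_expn2 k : INR (2 ^ k) = Rpower 2 (INR k).
Proof.
rewrite Rpower_pow; last by apply: IZR_lt.
elim: k => [|k IH]; first by [].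
by rewrite expnS mult_INR IH.
Qed.

Theorem theorem3 :
  exists C : R, (0 < C)%R /\
  forall N : nat, exists n : nat, (N <= n)%N /\
    forall (f : seq bool -> seq bool -> option nat)
           (label : rel 'I_n -> 'I_n -> seq bool),
      is_distance_labeling_scheme f label ->
      exists (G : rel 'I_n) (v : 'I_n),
        maxdeg3_graph G /\
        (INR (SumIndex n) / Rpower 2 (C * sqrt (ln (INR n) / ln 2))
           <= INR (size (label G v)))%R.
Proof.
exists 19%R; split; first exact: IZR_lt.
move=> N; pose t := N.+1; exists (2 ^ (t * (t + 16))); split.
  apply: leq_trans (ltnW (ltn_expl _ (ltnSn 1))).
  by rewrite /t; nia.
set n := 2 ^ _ => f label scheme.
have [G [v [Gdeg leSI]]] : exists (G : rel 'I_n) v, maxdeg3_graph G /\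
    SumIndex n <= 2 ^ (19 * t) * size (label G v).
  case: (classic (exists (G : rel 'I_n) v, maxdeg3_graph G /\
    SumIndex n <= 2 ^ (19 * t) * size (label G v))) => // none.
  have lt_SI (G : rel 'I_n) v : maxdeg3_graph G ->
      2 ^ (19 * t) * size (label G v) < SumIndex n.
    by move=> Gdeg; rewrite ltnNge; apply/negP => le; apply: none; exists G, v.
  (* If all labels were too short, they would have at most [L] bits, whence [SumIndex n <= 2^(19t) *
     L <= SumIndex n - 1]. *)
  pose L := (SumIndex n).-1 %/ 2 ^ (19 * t).
  have leL (G : rel 'I_n) v : maxdeg3_graph G -> size (label G v) <= L.
    by move=> /lt_SI - /(_ v) lt; rewrite leq_divRL ?expn_gt0 // mulnC; lia.
  have n_gt1 : 1 < n by rewrite -{1}[1](expn0 2) ltn_exp2l.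
  have [G [v [Gdeg sz]]] := label_nonempty n_gt1 scheme.
  have L_gt0 := leq_trans sz (leL G v Gdeg).
  have := SumIndex_leq scheme leL L_gt0; rewrite -/n [_ * L]mulnC leqNgt.
  move=> /negP[]; rewrite -(ltn_predK (lt_SI G v Gdeg)) ltnS.
  exact: leq_divM.
exists G, v; split=> //.
have ln2_gt0 : (0 < ln 2)%R by rewrite -ln_1; apply: ln_increasing; lra.
have -> : (ln (INR n) / ln 2 = INR (t * (t + 16)))%R.
  by rewrite INR_expn2 /Rpower ln_exp; field; lra.
(* Since [log n = t * (t + 16) >= t^2], the factor [2^(19t)] is at most [2^(19 sqrt(log n))]. *)
have le_t : (INR t <= sqrt (INR (t * (t + 16))))%R.
  rewrite -[X in (X <= _)%R]sqrt_Rsqr; last exact: pos_INR.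
  apply: sqrt_le_1_alt; rewrite /Rsqr -mult_INR; apply: le_INR; nia.
apply: (Rmult_le_reg_r (Rpower 2 (19 * sqrt (INR (t * (t + 16))))));
  first exact: exp_pos.
rewrite /Rdiv Rmult_assoc Rinv_l ?Rmult_1_r; last exact: Rgt_not_eq (exp_pos _).
apply: (@Rle_trans _ (INR (2 ^ (19 * t) * size (label G v)))).
  by apply: le_INR; apply/leP.
rewrite mult_INR Rmult_comm; apply: Rmult_le_compat_l; first exact: pos_INR.
rewrite INR_expn2; apply: Rle_Rpower; first by lra.
rewrite mult_INR; apply: Rmult_le_compat; try exact: pos_INR; last by [].
by rewrite INR_IZR_INZ; apply: Rle_refl.
Qed.
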